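(* Let $k$ be a field, let $R$ be a $k$-algebra, and let $A=R[\mathcal{S},\mathcal{D};\sigma,\delta]$ be a differential difference algebra of type $(m,n)$ over $R$, $m,n\ge 1$, with $\mathcal{S}=\{S_1,\dots,S_m\}$, $\mathcal{D}=\{D_1,\dots,D_n\}$, automorphisms $\sigma_1,\dots,\sigma_m$ and derivations $\delta_1,\dots,\delta_n$. Suppose that for every finite dimensional subspace $U$ of $R$ there exist a finite dimensional subspace $V$ of $R$ and an integer $p\geq 1$ such that $$U\subseteq V,\quad \sigma_i(V)\subseteq V,\quad \delta_j(V)\subseteq V^p,\qquad 1\leq i\leq m,\ 1\leq j\leq n.$$ Then $$\operatorname{GKdim}(R)+m+n\leq \operatorname{GKdim}(A)\leq 2\operatorname{GKdim}(R)+m+n.$$ Furthermore, if for all $1\leq i\leq m$ and $1\leq j\leq n$ the element $\sigma_i(D_j)$ is contained in the $k$-vector space spanned by $\{D_1,\ldots,D_n\}$, then $$\operatorname{GKdim}(A)=\operatorname{GKdim}(R)+m+n.$$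
   Context: All algebras are unital associative $k$-algebras, $k$ a field. For a subspace $V$ of an algebra, $V^r$ is the $k$-span of all products of $r$ elements of $V$. The Gelfand-Kirillov dimension of a $k$-algebra $A$ is $\operatorname{GKdim}(A)=\sup_V\limsup_{r\to\infty}\log_r\dim_k(V^r)$, the supremum over all finite dimensional subspaces $V$ of $A$ (it may be $\infty$). A derivation on $R$ is a $k$-linear map $\delta:R\to R$ with $\delta(ab)=a\delta(b)+\delta(a)b$. Definition. An algebra $A$ is a differential difference algebra of type $(m,n)$, $m,n\geq 1$, over a subalgebra $R\subseteq A$, written $A=R[\mathcal{S},\mathcal{D};\sigma,\delta]$, if there exist elements $S_1,\ldots,S_m,D_1,\ldots,D_n$ in $A$ such that: (i) the set $\{S_1^{\alpha_1}\cdots S_m^{\alpha_m}D_1^{\beta_1}\cdots D_n^{\beta_n}:\alpha\in\mathbb{N}^m,\beta\in\mathbb{N}^n\}$ (with $0\in\mathbb{N}$) is a basis of $A$ as a free left $R$-module; (ii) $D_ir=rD_i+\delta_i(r)$ for $1\leq i\leq n$, $r\in R$, where $\delta_i$ is a derivation on $R$; (iii) $S_ir=\sigma_i(r)S_i$ for $1\leq i\leq m$, $r\in R$, where $\sigma_i$ is a $k$-algebra automorphism of the subalgebra $R[D_1,\ldots,D_n]\subseteq A$ (generated by $R$ and $D_1,\dots,D_n$) such that $\sigma_i|_R$ is an automorphism of $R$ and $\sigma_i(D_j)=\sum_{l=1}^n a_{ijl}D_l$ with $a_{ijl}\in R$; (iv) $S_iS_j=S_jS_i$ for $1\leq i,j\leq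 m$, and $D_iD_j=D_jD_i$ for $1\leq i,j\leq n$; (v) $D_iS_j=S_j\sigma_j(D_i)$ for $1\leq i\leq n$, $1\leq j\leq m$; (vi) $\delta_i\circ\delta_j=\delta_j\circ\delta_i$ for $1\le i,j\le n$ and $\sigma_{i}\circ\sigma_{j}=\sigma_{j}\circ\sigma_{i}$ for $1\le i,j\le m$. *)

(* Defs.v *)
From HB Require Import structures.
From mathcomp Require Import all_boot all_order all_algebra.
From mathcomp Require Import all_classical all_reals all_analysis.

Set Implicit Arguments.
Unset Strict Implicit.
Unset Printing Implicit Defensive.

Import Order.TTheory GRing.Theory Num.Theory.

Local Open Scope classical_set_scope.
Local Open Scope ring_scope.

(* A subspace or a subalgebra of a k-algebra A, possibly of infinite
   dimension, is a set of elements of A.  A k-algebra of MathComp satisfies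
   1 != 0, so that the zero algebra is excluded. *)

Section LinearAlgebra.
Variables (k : fieldType) (E : lmodType k).

Definition kspan (X : set E) : set E :=
  smallest (fun W : set E => GRing.submod_closed [in W]) X.

Definition kfree (d : nat) (b : 'I_d -> E) : Prop :=
  forall c : 'I_d -> k, \sum_(i < d) c i *: b i = 0 -> forall i, c i = 0.

Definition kbasis (V : set E) (d : nat) (b : 'I_d -> E) : Prop :=
  kfree b /\ kspan (range b) = V.

Definition is_kdim (V : set E) (d : nat) : Prop :=
  exists b : 'I_d -> E, kbasis V b.

(* A set with a finite basis is a span, hence a subspace. *)
Definition findim_subspace (V : set E) : Prop := exists d, is_kdim V d.

(* Meaningful for finite dimensional subspaces only: 0 for any other set. *)
Definition kdim (V : set E) : nat := xget 0%N [set d | is_kdim V d].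

End LinearAlgebra.

Section Algebra.
Variables (k : fieldType) (A : algType k).

Definition powsub (V : set A) (r : nat) : set A :=
  kspan [set x | exists2 f : 'I_r -> A,
                   forall i, V (f i) & x = \prod_(i < r) f i].

Definition subalgebra (B : set A) : Prop := GRing.subalg_closed [in B].

Definition gen_subalgebra (X : set A) : set A := smallest subalgebra X.

(* log_r (dim_k V^r), with log_r 0 = -oo; the values at r = 0 and r = 1 do not
   affect the upper limit. *)
Definition log_growth (Rr : realType) (V : set A) (r : nat) : \bar Rr :=
  (lne ((kdim (powsub V r))%:R%:E) * ((ln (r%:R : Rr))^-1)%:E)%E.

(* The GK dimension of the subalgebra B of A; that of A is GKdim [set: A]. *)
Definition GKdim (Rr : realType) (B : set A) : \bar Rr :=
  ereal_sup [set limn_esup (log_growth Rr V) |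
             V in [set V : set A | findim_subspace V /\ V `<=` B]].

(* The maps below are defined on A, but only their values on the subalgebra B
   matter. *)

Definition klinear_on (B : set A) (f : A -> A) : Prop :=
  forall (a : k) (x y : A), B x -> B y -> f (a *: x + y) = a *: f x + f y.

Definition derivation_on (B : set A) (d : A -> A) : Prop :=
  [/\ set_fun B B d, klinear_on B d &
      forall x y, B x -> B y -> d (x * y) = x * d y + d x * y].

Definition alg_automorphism_on (B : set A) (f : A -> A) : Prop :=
  [/\ set_bij B B f, klinear_on B f, f 1 = 1 &
      forall x y, B x -> B y -> f (x * y) = f x * f y].

Definition commute_on (B : set A) (f g : A -> A) : Prop :=
  forall x, B x -> f (g x) = g (f x).

(* The family b is a basis of A as a left B-module; in particular b is
   injective. *)
Definition left_module_basis (B : set A) (I : eqType) (b : I -> A) : Prop :=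
  (forall x : A, exists (s : seq I) (c : I -> A),
      (forall i, B (c i)) /\ x = \sum_(i <- s) c i * b i) /\
  (forall (s : seq I) (c : I -> A), uniq s -> (forall i, B (c i)) ->
      \sum_(i <- s) c i * b i = 0 -> forall i, i \in s -> c i = 0).

Definition monomial (m n : nat) (S : 'I_m -> A) (D : 'I_n -> A)
    (e : {ffun 'I_m -> nat} * {ffun 'I_n -> nat}) : A :=
  (\prod_(i < m) S i ^+ e.1 i) * (\prod_(j < n) D j ^+ e.2 j).

Record diff_diff_algebra (R : set A) (m n : nat)
    (S : 'I_m -> A) (D : 'I_n -> A)
    (sigma : 'I_m -> A -> A) (delta : 'I_n -> A -> A) : Prop := {
  dda_subalgebra : subalgebra R;
  dda_basis : left_module_basis R (monomial S D);
  dda_derivation : forall i, derivation_on R (delta i);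
  dda_D_coef : forall i r, R r -> D i * r = r * D i + delta i r;
  dda_automorphism : forall i,
    alg_automorphism_on (gen_subalgebra (R `|` range D)) (sigma i);
  dda_automorphism_R : forall i, alg_automorphism_on R (sigma i);
  dda_sigma_D : forall i j, exists2 a : 'I_n -> A,
    forall l, R (a l) & sigma i (D j) = \sum_(l < n) a l * D l;
  dda_S_coef : forall i r, R r -> S i * r = sigma i r * S i;
  dda_S_comm : forall i j, S i * S j = S j * S i;
  dda_D_comm : forall i j, D i * D j = D j * D i;
  dda_D_S : forall i j, D i * S j = S j * sigma j (D i);
  dda_delta_comm : forall i j, commute_on R (delta i) (delta j);
  dda_sigma_comm : forall i j,
    commute_on (gen_subalgebra (R `|` range D)) (sigma i) (sigma j)
}.

End Algebra.

(* Main.v *)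
Require Import Defs.
From HB Require Import structures.
From mathcomp Require Import all_boot all_order all_algebra.
From mathcomp Require Import all_classical all_reals all_analysis.
From mathcomp Require Import ring lra.

Set Implicit Arguments.
Unset Strict Implicit.
Unset Printing Implicit Defensive.

Import Order.TTheory GRing.Theory Num.Theory.

Local Open Scope classical_set_scope.
Local Open Scope ring_scope.

(* Lower bound: if W contains V, 1, the S_i and the D_j, then W^((1+m+n)r)
   contains the free family b_i S^alpha D^beta with b a basis of V^r and all
   exponents < r, so that dim W^((1+m+n)r) >= r^(m+n) dim V^r.

   Upper bound: a finite dimensional X lies in W^Q, where W is made of the S_i,
   the D_j and a stable V containing 1 and the coefficients a_ijl.  Straightening
   D_j S^alpha costs a factor in V^|alpha|, and commuting D_j with V^N costs a
   factor in V^p, so W^r lies in the span of V^N S^alpha D^beta with exponents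
   <= r and N = r (p + q m r), where q = 1.  The quadratic N is the reason for
   2 GKdim(R).  When the a_ijl are scalars, straightening is free: q = 0 and N is
   linear in r. *)

(** * Subspaces and their dimension *)

Section Span.
Variables (k : fieldType) (E : lmodType k).
Implicit Types V W X Y : set E.

(** [GRing.submod_closed [in W]] stripped of the boolean membership, so that plain sets can be used
    throughout. *)
Definition submodule W : Prop :=
  W 0 /\ forall (a : k) x y, W x -> W y -> W (a *: x + y).

Lemma submod_closedE W : GRing.submod_closed [in W] <-> submodule W.
Proof.
split=> -[W0 WD]; split; first by rewrite inE in W0.
- by move=> a x y Wx Wy; apply/set_mem/WD; exact/mem_set.
- exact/mem_set.
- by move=> a x y /set_mem Wx /set_mem Wy; exact/mem_set/WD.
Qed.

Lemma submoduleD W x y : submodule W -> W x -> W y -> W (x + y).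
Proof. by move=> [_ WD] Wx Wy; rewrite -[x]scale1r; exact: WD. Qed.

Lemma submoduleZ W a x : submodule W -> W x -> W (a *: x).
Proof. by move=> [W0 WD] Wx; rewrite -[a *: x]addr0; exact: WD. Qed.

Lemma submodule_sum W (I : eqType) (s : seq I) (x : I -> E) :
  submodule W -> (forall i, i \in s -> W (x i)) -> W (\sum_(i <- s) x i).
Proof.
move=> Wsub Wx; rewrite big_seq; elim/big_ind: _ => //; first by case: Wsub.
by move=> y z; exact: submoduleD.
Qed.

Lemma submodule_lin W (I : finType) (c : I -> k) (x : I -> E) :
  submodule W -> (forall i, W (x i)) -> W (\sum_i c i *: x i).
Proof. by move=> Wsub Wx; apply: submodule_sum => // i _; exact: submoduleZ. Qed.

(** Stated for an [f] linear on [B] only, since [sigma i] and [delta j] are controlled only on [R];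
    it supplies the subspace condition of later inductions on powers. *)
Lemma submodule_preimage (B C : set E) (f : E -> E) :
    submodule B -> submodule C -> f 0 = 0 ->
    (forall a x y, B x -> B y -> f (a *: x + y) = a *: f x + f y) ->
  submodule [set x | B x /\ C (f x)].
Proof.
move=> [B0 BD] [C0 CD] f0 fD; split=> [|a x y [Bx Cx] [By Cy]] /=.
  by rewrite f0.
by split; [exact: BD|rewrite fD//; exact: CD].
Qed.

Lemma kspan_submodule X : submodule (kspan X).
Proof.
split=> [W [/submod_closedE[]//]|a x y Xx Xy W WX].
have [/submod_closedE[_ WD] _] := WX.
by apply: WD; [exact: Xx|exact: Xy].
Qed.

Lemma sub_kspan X : X `<=` kspan X.
Proof. exact: sub_gen_smallest. Qed.

Lemma kspan_sub X W : submodule W -> X `<=` W -> kspan X `<=` W.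
Proof. by move=> /submod_closedE; exact: smallest_sub. Qed.

Lemma kspan_rangeP (I : finType) (x : I -> E) y :
  kspan (range x) y <-> exists c : I -> k, y = \sum_i c i *: x i.
Proof.
split=> [|[c ->]].
  apply: (@kspan_sub _ [set y | exists c, y = \sum_i c i *: x i]).
    split=> [|a _ _ [c ->] [d ->]].
      by exists (fun=> 0); rewrite big1// => i _; rewrite scale0r.
    exists (fun i => a * c i + d i); rewrite scaler_sumr -big_split/=.
    by apply: eq_bigr => i _; rewrite scalerDl scalerA.
  move=> _ [i _ <-]; exists (fun j => (j == i)%:R).
  rewrite (bigD1 i)//= eqxx scale1r big1 ?addr0// => j /negbTE->.
  by rewrite scale0r.
by apply: submodule_lin => [|i]; [exact: kspan_submodule|exact: sub_kspan].
Qed.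

(** [kfree] over any finite index type, for families indexed by pairs of a basis index and exponent
    vectors. *)
Definition free_family (I : finType) (x : I -> E) : Prop :=
  forall c : I -> k, \sum_i c i *: x i = 0 -> forall i, c i = 0.

(** If [I] were larger, the matrix of coefficients of [b] in terms of [x] would have more rows than
    columns; a nonzero vector of its left kernel is a linear relation between the [b i]. *)
Lemma leq_free_span (I J : finType) (b : I -> E) (x : J -> E) :
  free_family b -> (forall i, kspan (range x) (b i)) -> (#|I| <= #|J|)%N.
Proof.
move=> bfree bx; rewrite leqNgt; apply/negP => ltJI.
have /choice[C bE] : forall i, exists c : J -> k, b i = \sum_j c j *: x j.
  by move=> i; exact/kspan_rangeP.
pose M := \matrix_(i < #|I|, j < #|J|) C (enum_val i) (enum_val j).
have /rowV0Pn[u uM u0] : kermx M != 0.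
  rewrite kermx_eq0 -row_leq_rank -ltnNge.
  exact: leq_ltn_trans (rank_leq_col _) ltJI.
move/sub_kermxP in uM.
case/rV0Pn: u0 => i /negP; apply; apply/eqP.
rewrite -(enum_valK i).
apply: (bfree (fun i => u 0 (enum_rank i))).
transitivity (\sum_j (\sum_i u 0 (enum_rank i) * C i j) *: x j).
  under [RHS]eq_bigr do rewrite scaler_suml.
  rewrite exchange_big/=; apply: eq_bigr => a _.
  by rewrite bE scaler_sumr; apply: eq_bigr => j _; rewrite scalerA.
apply: big1 => j _; move/matrixP: uM => /(_ 0 (enum_rank j)).
rewrite !mxE => uM; rewrite (_ : \sum_a _ = 0) ?scale0r// -[RHS]uM.
rewrite (reindex (@enum_val I I))/=; last first.
  by exists enum_rank => a _; rewrite ?enum_valK ?enum_rankK.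
by apply: eq_bigr => a _; rewrite !mxE enum_valK enum_rankK.
Qed.

Lemma is_kdim_uniq V d e : is_kdim V d -> is_kdim V e -> d = e.
Proof.
move=> [b [bfree bV]] [c [cfree cV]].
have le d1 e1 (b1 : 'I_d1 -> E) (c1 : 'I_e1 -> E) :
    kfree b1 -> kspan (range b1) = kspan (range c1) -> (d1 <= e1)%N.
  move=> b1free bc; rewrite -(card_ord d1) -(card_ord e1).
  apply: (leq_free_span b1free (x := c1)) => i.
  have : kspan (range b1) (b1 i) by apply: sub_kspan; exists i.
  by rewrite bc.
by apply/eqP; rewrite eqn_leq (le _ _ b c)// ?(le _ _ c b)// bV cV.
Qed.

Lemma kdimE V d : is_kdim V d -> kdim V = d.
Proof.
by move=> Vd; apply: (is_kdim_uniq _ Vd); rewrite /kdim; case: xgetP => // /(_ d).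
Qed.

(* A free family of maximal size in V is a basis. *)
Lemma findim_bounded (J : finType) (x : J -> E) V :
    submodule V -> V `<=` kspan (range x) ->
  findim_subspace V /\ (kdim V <= #|J|)%N.
Proof.
move=> Vsub Vx.
pose P d := `[< exists b : 'I_d -> E, kfree b /\ forall i, V (b i) >].
have P0 : exists d, P d.
  by exists 0%N; apply/asboolP; exists (fun=> 0); split=> [c _|] i; have := ltn_ord i.
have PJ d : P d -> (d <= #|J|)%N.
  move=> /asboolP[b [bfree bV]]; rewrite -(card_ord d).
  by apply: (leq_free_span bfree (x := x)) => i; apply: Vx.
case: (ex_maxnP P0 PJ) => d /asboolP[b [bfree bV]] dmax.
suff Vd : is_kdim V d.
  split; first by exists d.
  by rewrite (kdimE Vd); apply: PJ; apply/asboolP; exists b.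
exists b; split=> //; apply/seteqP; split.
  by apply: kspan_sub => // _ [i _ <-].
move=> v Vv; apply: contrapT => nbv.
suff /dmax : P d.+1 by rewrite ltnn.
apply/asboolP; exists (fun i => if unlift ord0 i is Some j then b j else v).
split; last by move=> i; case: unliftP => [j|] _.
move=> c; rewrite big_ord_recl unlift_none.
under eq_bigr do rewrite liftK.
have [c0|c0] := eqVneq (c ord0) 0.
  rewrite c0 scale0r add0r => /bfree cl i.
  by case: (unliftP ord0 i) => [j ->|->].
move=> /eqP; rewrite addr_eq0 => /eqP cv; case: nbv; apply/kspan_rangeP.
exists (fun i => - (c ord0)^-1 * c (lift ord0 i)).
rewrite -[LHS](scalerK c0) cv scalerN scaler_sumr -sumrN.
by apply: eq_bigr => i _; rewrite scalerA mulNr scaleNr.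
Qed.

Lemma findim_span (J : finType) (x : J -> E) : findim_subspace (kspan (range x)).
Proof. by have [] := findim_bounded (kspan_submodule (range x)) (@subset_refl _ _). Qed.

Lemma findim_span_seq (s : seq E) : findim_subspace (kspan [set` s]).
Proof.
rewrite (_ : [set` s] = range (tnth (in_tuple s))); first exact: findim_span.
apply/seteqP; split=> [y /= ys|_ [i _ <-]]; last exact: mem_tnth.
by have /tnthP[i ->] : y \in in_tuple s by []; exists i.
Qed.

Lemma findim_submodule V : findim_subspace V -> submodule V.
Proof. by move=> [d [b [_ <-]]]; exact: kspan_submodule. Qed.

Lemma findim_basis V : findim_subspace V -> exists b : 'I_(kdim V) -> E, kbasis V b.
Proof. by move=> [d Vd]; rewrite (kdimE Vd). Qed.

Lemma leq_free_kdim (I : finType) (x : I -> E) V :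
  findim_subspace V -> free_family x -> (forall i, V (x i)) -> (#|I| <= kdim V)%N.
Proof.
move=> /findim_basis[b [_ bV]] xfree Vx; rewrite -[leqRHS]card_ord.
by apply: (leq_free_span xfree (x := b)) => i; rewrite bV.
Qed.

Lemma leq_kdim V W : findim_subspace V -> findim_subspace W -> V `<=` W ->
  (kdim V <= kdim W)%N.
Proof.
move=> Vfin /findim_basis[b [_ bW]] VW; rewrite -[leqRHS]card_ord.
by apply: (findim_bounded (x := b) (findim_submodule Vfin) _).2; rewrite bW.
Qed.

Lemma kdim_gt0 V x : findim_subspace V -> V x -> x != 0 -> (0 < kdim V)%N.
Proof.
move=> Vfin Vx x0; have := @leq_free_kdim unit (fun=> x) V Vfin.
rewrite card_unit; apply=> // c.
rewrite (big_pred1 tt) => [/eqP|[]//].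
by rewrite scaler_eq0 (negPf x0) orbF => /eqP c0 [].
Qed.

End Span.

(** * Powers of a subspace *)

Section Powsub.
Variables (k : fieldType) (A : algType k).
Implicit Types V W X Y : set A.

(** Multiplication is bilinear: with one factor fixed, the other ranges over a subspace, so
    generators suffice on each side in turn. *)
Lemma kspan_mul X Y W x y : submodule W ->
    (forall a b, X a -> Y b -> W (a * b)) ->
  kspan X x -> kspan Y y -> W (x * y).
Proof.
move=> [W0 WD] XYW Xx Yy.
apply: (@kspan_sub _ _ X [set x | W (x * y)]) Xx => [|a Xa] /=.
  by split=> /= [|c u v Wu Wv]; rewrite ?mul0r// mulrDl -scalerAl; exact: WD.
apply: (@kspan_sub _ _ Y [set y | W (a * y)]) Yy => [|b Yb] /=; last exact: XYW.
by split=> /= [|c u v Wu Wv]; rewrite ?mulr0// mulrDr -scalerAr; exact: WD.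
Qed.

Lemma kspan_mull X W a x : submodule W ->
  (forall b, X b -> W (a * b)) -> kspan X x -> W (a * x).
Proof.
move=> Wsub XW; apply: (@kspan_mul [set a] X W) => // [_ b ->|]; first exact: XW.
exact: sub_kspan.
Qed.

Lemma kspan_mulr X W a x : submodule W ->
  (forall b, X b -> W (b * a)) -> kspan X x -> W (x * a).
Proof.
move=> Wsub XW Xx; apply: (@kspan_mul X [set a] W) Xx _ => // [b _ Xb ->|].
  exact: XW.
exact: sub_kspan.
Qed.

Lemma powsub_submodule V r : submodule (powsub V r).
Proof. exact: kspan_submodule. Qed.

Lemma powsub0 V : powsub V 0 1.
Proof.
by apply: sub_kspan; exists (fun=> 0); [move=> i; have := ltn_ord i|rewrite big_ord0].
Qed.

Lemma powsub_cons V r v x : V v -> powsub V r x -> powsub V r.+1 (v * x).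
Proof.
move=> Vv; apply: kspan_mull => [|_ [f Vf ->]]; first exact: powsub_submodule.
apply: sub_kspan.
exists (fun i => if unlift ord0 i is Some j then f j else v).
  by move=> i; case: unliftP.
rewrite big_ord_recl unlift_none; congr (_ * _).
by apply: eq_bigr => i _; rewrite liftK.
Qed.

(** Induction principle for powers: products span [powsub V r], and each is built from 1 by left
    multiplications by elements of [V]. *)
Lemma powsub_ind V (P : nat -> set A) : (forall r, submodule (P r)) -> P 0%N 1 ->
    (forall r v x, V v -> P r x -> P r.+1 (v * x)) ->
  forall r, powsub V r `<=` P r.
Proof.
move=> Psub P1 PS r; apply: kspan_sub => // _ [f Vf ->].
elim: r f Vf => [|r IHr] f Vf; first by rewrite big_ord0.
by rewrite big_ord_recl; apply: PS => //; exact: IHr.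
Qed.

Lemma powsub_gen V v : V v -> powsub V 1 v.
Proof. by move=> Vv; rewrite -[v]mulr1; apply: powsub_cons => //; exact: powsub0. Qed.

Lemma powsubM V a b x y :
  powsub V a x -> powsub V b y -> powsub V (a + b) (x * y).
Proof.
move=> Vx Vy.
apply: (@powsub_ind V (fun r => [set x | powsub V (r + b) (x * y)])) Vx => [r||r v z Vv].
- split=> /= [|c u v]; first by rewrite mul0r; case: (powsub_submodule V (r + b)).
  by rewrite mulrDl -scalerAl; case: (powsub_submodule V (r + b)) => _; apply.
- by rewrite /= mul1r.
- by rewrite /= -mulrA; exact: powsub_cons.
Qed.

Lemma powsub_exp V v r : V v -> powsub V r (v ^+ r).
Proof.
move=> Vv; elim: r => [|r IHr]; first by rewrite expr0; exact: powsub0.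
by rewrite exprS; exact: powsub_cons.
Qed.

Lemma powsub_prod V (I : Type) (s : seq I) (x : I -> A) (e : I -> nat) :
    (forall i, powsub V (e i) (x i)) ->
  powsub V (\sum_(i <- s) e i) (\prod_(i <- s) x i).
Proof.
move=> Vx; elim: s => [|i s IHs]; rewrite ?big_nil ?big_cons; first exact: powsub0.
exact: powsubM.
Qed.

(** A shorter product is padded with factors 1. *)
Lemma powsub_leq V a b : V 1 -> (a <= b)%N -> powsub V a `<=` powsub V b.
Proof.
move=> V1 /subnK<- x Vx; rewrite -[x]mul1r -(expr1n _ (b - a)).
by apply: powsubM => //; exact: powsub_exp.
Qed.

Lemma powsub_powsub V X q r :
  X `<=` powsub V q -> powsub X r `<=` powsub V (q * r).
Proof.
move=> XV; apply: (@powsub_ind X (fun r => powsub V (q * r))) => [s||s v x Xv Vx].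
- exact: powsub_submodule.
- by rewrite muln0; exact: powsub0.
- by rewrite mulnS; apply: powsubM => //; exact: XV.
Qed.

Lemma powsub_subset V W r : V `<=` W -> powsub V r `<=` powsub W r.
Proof.
move=> VW; rewrite -[r in powsub W r]mul1n; apply: powsub_powsub => x /VW.
exact: powsub_gen.
Qed.

Lemma subalgebraP (B : set A) : subalgebra B ->
  [/\ submodule B, B 1 & forall x y, B x -> B y -> B (x * y)].
Proof.
move=> Balg; split.
- exact/submod_closedE/(GRing.subalg_closedZ Balg).
- by case: Balg => /set_mem.
- by case: Balg => _ _ BM x y /mem_set Bx /mem_set By; exact/set_mem/BM.
Qed.

Lemma powsub_subalgebra (B : set A) V r : subalgebra B -> V `<=` B ->
  powsub V r `<=` B.
Proof.
move=> /subalgebraP[Bsub B1 BM] VB; apply: (@powsub_ind V (fun=> B)) => // s v x Vv Bx.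
by apply: BM => //; exact: VB.
Qed.

(** The finitely many words of length [r] in a basis of [V] span the power. *)
Lemma findim_powsub V r : findim_subspace V -> findim_subspace (powsub V r).
Proof.
move=> [d [b [_ Vb]]].
suff : powsub V r `<=`
    kspan (range (fun t : {ffun 'I_r -> 'I_d} => \prod_(i < r) b (t i))).
  by move=> /(findim_bounded (powsub_submodule _ _))[].
pose P r := kspan (range (fun t : {ffun 'I_r -> 'I_d} => \prod_(i < r) b (t i))).
apply: (@powsub_ind V P) => [s||s v x]; first exact: kspan_submodule.
  apply: sub_kspan; exists (ffun0 (card_ord 0)) => //.
  by rewrite big_ord0.
rewrite -Vb; apply: kspan_mul; first exact: kspan_submodule.
move=> _ _ [i _ <-] [t _ <-]; apply: sub_kspan.
exists [ffun j => if unlift ord0 j is Some l then t l else i] => //.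
rewrite big_ord_recl ffunE unlift_none; congr (_ * _).
by apply: eq_bigr => j _; rewrite ffunE liftK.
Qed.

Lemma kdim_powsub_gt0 V r : findim_subspace V -> V 1 -> (0 < kdim (powsub V r))%N.
Proof.
move=> Vfin V1; apply: (@kdim_gt0 _ _ _ 1); rewrite ?oner_neq0//.
  exact: findim_powsub.
by rewrite -(expr1n _ r); exact: powsub_exp.
Qed.

End Powsub.

(** * Upper limits of logarithmic ratios *)

Section Growth.
Variable Rr : realType.

(** An eventual bound by [x] bounds the supremum of a tail, hence the upper limit; then the real
    number [x] decreases to [l], which may be [-oo]. *)
Lemma limn_esup_le (u : nat -> \bar Rr) (l : \bar Rr) :
    (forall x : Rr, (l < x%:E)%E ->
       exists N, forall n, (N <= n)%N -> (u n <= x%:E)%E) ->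
  (limn_esup u <= l)%E.
Proof.
move=> ul.
have ux (x : Rr) : (l < x%:E)%E -> (limn_esup u <= x%:E)%E.
  move=> /ul[N uN]; rewrite /limn_esup limf_esupE.
  apply: (@le_trans _ _ (ereal_sup [set u n | n in [set n | (N <= n)%N]])).
    apply: ereal_inf_lbound; exists [set n | (N <= n)%N] => //; by exists N.
  by apply: ge_ereal_sup => _ [n /= Nn <-]; exact: uN.
case: l ul ux => [l| |] _ ux; last 1 first.
- rewrite leeNy_eq; apply/eqP/eq_ninfty => x; apply: ux; exact: ltNyr.
- by apply/lee_addgt0Pr => e e0; apply: ux; rewrite lte_fin ltrDl.
- by rewrite leey.
Qed.

Lemma limn_esup_lt (u : nat -> \bar Rr) (l : \bar Rr) : (limn_esup u < l)%E ->
  exists N, forall n, (N <= n)%N -> (u n <= l)%E.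
Proof.
rewrite /limn_esup limf_esupE => /ereal_inf_lt[_ [V [N _ NV] <-] Vl].
exists N => n Nn; apply/ltW/(le_lt_trans _ Vl).
by apply: ereal_sup_ubound; exists n => //; exact: NV.
Qed.

(** [log_growth Rr V] is by definition this ratio for [f r = kdim (powsub V r)]; freeing [f]
    separates the analysis from the algebra. *)
Definition log_ratio (f : nat -> nat) (r : nat) : \bar Rr :=
  (lne ((f r)%:R%:E) * ((ln (r%:R : Rr))^-1)%:E)%E.

Lemma log_ratioE f r : (0 < f r)%N ->
  log_ratio f r = (ln ((f r)%:R : Rr) / ln (r%:R))%:E.
Proof. by move=> fr0; rewrite /log_ratio lne_EFin ?ltr0n. Qed.

Lemma ln_natr_ge0 r : 0 <= ln (r%:R : Rr).
Proof. by case: r => [|r]; [rewrite ln0|rewrite ln_ge0 ?ler1n]. Qed.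

Lemma limn_esup_log_ratio_ge0 f : (forall r, (0 < f r)%N) ->
  (0 <= limn_esup (log_ratio f))%E.
Proof.
move=> f0; apply: limf_esup_ge0; first by case=> N _ /(_ N); apply => /=.
(* For [r <= 1] the logarithm [ln r] is 0 and so is its inverse, hence no case distinction. *)
by move=> r; rewrite log_ratioE// lee_fin divr_ge0 ?ln_natr_ge0.
Qed.

(** Take logarithms and divide by [ln r]: the argument [s = c * r ^ e] has [ln s = ln c + e * ln r],
    which produces the factor [e], and the constants [c] and [C] vanish in the limit. Both bounds on
    the GK dimension are instances. *)
Lemma log_ratio_comparison (f g : nat -> nat) (a b c e C : nat) :
    (0 < c)%N -> (0 < e)%N -> (0 < C)%N -> (forall r, (0 < g r)%N) ->
    (forall r, (0 < r)%N -> (f r * r ^ a <= C * g (c * r ^ e) * r ^ b)%N) ->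
  (limn_esup (log_ratio f) + a%:R%:E <=
     e%:R%:E * limn_esup (log_ratio g) + b%:R%:E)%E.
Proof.
move=> c0 e0 C0 g0 fg.
have := limn_esup_log_ratio_ge0 g0.
have := @limn_esup_lt (log_ratio g).
(* The value [-oo] contradicts nonnegativity, and [+oo] makes the right-hand side infinite because
   [e] is positive. *)
case: (limn_esup (log_ratio g)) => [G| |] Glim; last by [].
2: rewrite gt0_muley ?lte_fin ?ltr0n//. 2: by move=> _; rewrite addye// leey.
rewrite lee_fin => G0.
rewrite -EFinM -EFinD -leeBrDr// -EFinB.
apply: limn_esup_le => x; rewrite lte_fin => Gx.
set eps := x - (e%:R * G + b%:R - a%:R).
have eps0 : 0 < eps by rewrite subr_gt0.
have eR0 : 0 < e%:R :> Rr by rewrite ltr0n.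
(* The margin [eps] is halved: [e * y] exceeds [e * G] by [eps / 2], and the other half times [ln r]
   absorbs the constant [K] coming from [C] and [c]. *)
pose y := G + eps / 2 / e%:R.
have [|N gN] := Glim y%:E.
  by rewrite lte_fin ltrDl divr_gt0// divr_gt0.
have y0 : 0 <= y by rewrite addr_ge0// divr_ge0// ?divr_ge0// ltW.
pose K := ln (C%:R : Rr) + y * ln (c%:R).
have [M KM] : exists M : nat, expR (K / (eps / 2)) <= M%:R.
  by exists (Num.bound (expR (K / (eps / 2)))); rewrite ltW ?archi_boundP ?expR_ge0.
(* [N] makes the bound on [g] valid at [c * r ^ e >= r], [M] makes [K <= eps / 2 * ln r], and 2
   makes [ln r] positive. *)
exists (maxn (maxn N M) 2) => r.
rewrite !geq_max => /andP[/andP[Nr Mr] r2].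
have r0 : (0 < r)%N by exact: leq_trans r2.
(* [f] may vanish, as for the zero subspace; the ratio is then [-oo]. *)
have [f0|f0] := posnP (f r).
  rewrite /log_ratio f0 /lne lexx.
  by rewrite gt0_mulNye ?leNye// lte_fin invr_gt0 ln_gt0// ltr1n.
rewrite log_ratioE// lee_fin.
have lnr0 : 0 < ln (r%:R : Rr) by rewrite ln_gt0// ltr1n.
rewrite ler_pdivrMr//.
have r_cre : (r <= c * r ^ e)%N.
  by rewrite (leq_trans _ (leq_pmull _ c0))// -{1}(expn1 r) leq_pexp2l.
have := gN _ (leq_trans Nr r_cre).
rewrite log_ratioE// lee_fin ler_pdivrMr; last first.
  by rewrite ln_gt0// ltr1n (leq_trans r2).
have posn (n : nat) : (0 < n)%N -> (n%:R : Rr) \is Num.pos.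
  by move=> n0; rewrite posrE ltr0n.
have re0 : (0 < r ^ e)%N by rewrite expn_gt0 r0.
rewrite natrM lnM ?posn// natrX lnXn ?ltr0n// => lng.
have : ln (((f r * r ^ a)%N)%:R : Rr) <= ln ((C * g (c * r ^ e) * r ^ b)%N)%:R.
  rewrite ler_ln ?ler_nat ?fg// ?posn ?muln_gt0 ?f0 ?C0 ?g0 ?expn_gt0 ?r0//.
rewrite !natrM !lnM ?posn ?rpredM ?posn ?g0 ?expn_gt0 ?r0//.
rewrite !natrX !lnXn ?ltr0n// -[_ *+ a]mulr_natl -[_ *+ b]mulr_natl => lnf.
have KL : K <= eps / 2 * ln (r%:R).
  rewrite mulrC -ler_pdivrMr ?divr_gt0//.
  rewrite -[leLHS]expRK ler_ln ?posn ?posrE ?expR_gt0//.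
  by rewrite (le_trans KM)// ler_nat.
have ey : e%:R * y = e%:R * G + eps / 2.
  by rewrite /y mulrDr mulrCA divff ?gt_eqF// mulr1.
have -> : x = eps + e%:R * G + b%:R - a%:R by rewrite /eps; ring.
move: lng lnf KL; rewrite /K -[_ *+ e]mulr_natl mulrDr mulrA (mulrC y e%:R) ey.
by clearbody eps y; lra.
Qed.
End Growth.

(** * Differential difference algebras *)

Section DiffDiff.
Variables (k : fieldType) (A : algType k) (R : set A) (m n : nat).
Variables (S : 'I_m -> A) (D : 'I_n -> A).
Variables (sigma : 'I_m -> A -> A) (delta : 'I_n -> A -> A).
Hypothesis ddaA : diff_diff_algebra R S D sigma delta.

Let Ralg := subalgebraP (dda_subalgebra ddaA).

(** The factor [x i] commutes past the earlier powers until it meets its own. The induction is on a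
    duplicate-free list of indices, so exactly one exponent grows. *)
Lemma commuting_prod_bump (d : nat) (x : 'I_d -> A) (e : 'I_d -> nat) i :
    (forall i j, x i * x j = x j * x i) ->
  x i * \prod_j x j ^+ e j = \prod_j x j ^+ ((j == i) + e j).
Proof.
move=> xC; have: i \in index_enum 'I_d by exact: mem_index_enum.
have: uniq (index_enum 'I_d) by exact: index_enum_uniq.
elim: (index_enum _) => //= j s IHs /andP[js us]; rewrite in_cons !big_cons.
have [ij _|ij /= si] := eqVneq i j.
  rewrite -{j}ij in js *.
  rewrite exprS mulrA; congr (_ * _); rewrite big_seq [RHS]big_seq.
  apply: eq_bigr => l ls; case: eqVneq => // li; by move: js; rewrite -li ls.
by rewrite -IHs// !mulrA (commrX _ (xC i j)).
Qed.

(** Turns a power product into a word, so that a [D j] can be moved across it one letter at a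
    time. *)
Lemma prod_expr_word (d : nat) (x : 'I_d -> A) (e : 'I_d -> nat) :
  exists2 w : seq 'I_d, \prod_i x i ^+ e i = \prod_(i <- w) x i &
                        \sum_i e i = size w.
Proof.
elim: (index_enum _) => [|i s [w xw ew]]; first by exists [::]; rewrite ?big_nil.
exists (nseq (e i) i ++ w); rewrite big_cons ?big_cat/=.
  by rewrite xw big_nseq -Monoid.iteropE.
by rewrite ew size_cat size_nseq.
Qed.

Lemma monomial0 : monomial S D ([ffun=> 0%N], [ffun=> 0%N]) = 1.
Proof. by rewrite /monomial !big1 ?mulr1// => i _; rewrite ffunE. Qed.

(** The source is a finite type with [r ^ (m + n)] elements, which is what makes dimension counts
    possible. *)
Definition exponents (r : nat) (t : {ffun 'I_m -> 'I_r} * {ffun 'I_n -> 'I_r}) :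
    {ffun 'I_m -> nat} * {ffun 'I_n -> nat} :=
  ([ffun i => nat_of_ord (t.1 i)], [ffun j => nat_of_ord (t.2 j)]).

(** * Upper bound: straightening words into standard monomials *)

Section UpperBound.
Variables (V : set A) (p q : nat).
Hypotheses (VR : V `<=` R) (V1 : V 1) (p_gt0 : (0 < p)%N).
Hypothesis sigmaV : forall i, sigma i @` V `<=` V.
Hypothesis deltaV : forall j, delta j @` V `<=` powsub V p.
Hypothesis sigmaD : forall i j, exists2 a : 'I_n -> A,
  forall l, powsub V q (a l) & sigma i (D j) = \sum_(l < n) a l * D l.

Let powR r : powsub V r `<=` R.
Proof. exact: (powsub_subalgebra (dda_subalgebra ddaA)). Qed.

Lemma sigma_powsub i r x : powsub V r x -> powsub V r (sigma i x).
Proof.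
have [Rsub R1 RM] := Ralg.
have [_ sD s1 sM] := dda_automorphism_R ddaA i.
have s0 : sigma i 0 = 0.
  have := sD (-1) 1 1 R1 R1; rewrite scaleN1r addNr => ->.
  by rewrite scaleN1r addNr.
(* Membership in [R] is carried along because [sigma i] is used as a multiplicative map only
   there. *)
suff /(_ r x) H : forall r, powsub V r `<=` [set x | R x /\ powsub V r (sigma i x)].
  by case/H.
apply: powsub_ind => [t||t v y Vv [Ry Vy]].
- apply: submodule_preimage => //; exact: powsub_submodule.
- by split=> //; rewrite s1; exact: powsub0.
- split; first by apply: RM => //; exact: VR.
  rewrite sM//; last exact: VR.
  by apply: powsub_cons => //; apply: sigmaV; exists v.
Qed.

(** By the Leibniz rule one of the [r] factors is replaced by an element of [powsub V p]; the bound
    [r + p] instead of [r - 1 + p] avoids subtraction at [r = 0]. *)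
Lemma delta_powsub j r x : powsub V r x -> powsub V (r + p) (delta j x).
Proof.
have [Rsub R1 RM] := Ralg.
have [_ dD dM] := dda_derivation ddaA j.
have d0 : delta j 0 = 0.
  have := dD (-1) 1 1 R1 R1; rewrite scaleN1r addNr => ->.
  by rewrite scaleN1r addNr.
suff /(_ r x) H : forall r,
    powsub V r `<=` [set x | powsub V r x /\ powsub V (r + p) (delta j x)].
  by case/H.
apply: powsub_ind => [t||t v y Vv [Vy Vdy]].
- apply: submodule_preimage => // [||c y z /powR Ry /powR Rz]; last exact: dD.
    exact: powsub_submodule.
  exact: powsub_submodule.
- split; first exact: powsub0.
  (* The Leibniz rule for [1 * 1] forces [delta j 1 = 0]. *)
  have : delta j 1 = delta j 1 + delta j 1.
    by rewrite -{1}[1]mulr1 dM// mul1r mulr1.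
  move=> /eqP; rewrite -subr_eq0 opprD addrA subrr sub0r oppr_eq0 => /eqP->.
  by case: (powsub_submodule V (0 + p)).
- split; first exact: powsub_cons.
  rewrite dM; [|exact: VR|exact: powR Vy].
  apply: (submoduleD (powsub_submodule V (t.+1 + p))); first exact: powsub_cons.
  have : powsub V (p + t) (delta j v * y).
    by apply: powsubM => //; apply: (deltaV (j := j)); exists v.
  by apply: powsub_leq => //; rewrite addnC addSn.
Qed.

Definition std_span (r N : nat) : set A :=
  kspan [set x | exists v (e : {ffun 'I_m -> nat} * {ffun 'I_n -> nat}),
    [/\ powsub V N v, forall i, (e.1 i <= r)%N, forall j, (e.2 j <= r)%N &
        x = v * monomial S D e]].

Lemma std_span_submodule r N : submodule (std_span r N).
Proof. exact: kspan_submodule. Qed.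

Lemma std_span_leq r r' N N' : (r <= r')%N -> (N <= N')%N ->
  std_span r N `<=` std_span r' N'.
Proof.
move=> rr' NN'; apply: kspan_sub => [|_ [v [e [Vv e1 e2 ->]]]].
  exact: std_span_submodule.
apply: sub_kspan; exists v, e; split=> //; first exact: powsub_leq Vv.
- by move=> i; exact: leq_trans rr'.
- by move=> j; exact: leq_trans rr'.
Qed.

Lemma std_spanM r N N' v x :
  powsub V N v -> std_span r N' x -> std_span r (N + N') (v * x).
Proof.
move=> Vv; apply: kspan_mull => [|_ [u [e [Vu e1 e2 ->]]]].
  exact: std_span_submodule.
apply: sub_kspan; exists (v * u), e; split=> //; last by rewrite mulrA.
exact: powsubM.
Qed.

(** Passing [S i] across a coefficient applies [sigma i], which preserves the powers of [V]: only an
    exponent grows. *)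
Lemma std_spanS r N i x : std_span r N x -> std_span r.+1 N (S i * x).
Proof.
apply: kspan_mull => [|_ [v [e [Vv e1 e2 ->]]]]; first exact: std_span_submodule.
apply: sub_kspan; exists (sigma i v), ([ffun l => (l == i) + e.1 l], e.2)%N.
split=> /=; first exact: sigma_powsub.
- by move=> l; rewrite ffunE -add1n leq_add// leq_b1.
- by move=> l; exact: leqW.
rewrite mulrA (dda_S_coef ddaA); last exact: powR Vv.
rewrite -!mulrA; congr (_ * _); rewrite /monomial mulrA commuting_prod_bump.
  by congr (_ * _); apply: eq_bigr => l _; rewrite ffunE.
exact: (dda_S_comm ddaA).
Qed.

(** Crossing a letter, [D j * S i] becomes the sum of the [S i * a l * D l]; after the rest of the
    word is crossed, [S i] moves right past the coefficients through [sigma i]. Each letter thus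
    costs one factor in [powsub V q]. *)
Lemma D_word (w : seq 'I_m) j :
  kspan [set x | exists v l, powsub V (q * size w) v /\
                   x = v * (\prod_(i <- w) S i * D l)]
        (D j * \prod_(i <- w) S i).
Proof.
elim: w j => [|i w IHw] j.
  apply: sub_kspan; exists 1, j; rewrite muln0; split; first exact: powsub0.
  by rewrite big_nil !mul1r mulr1.
rewrite big_cons mulrA (dda_D_S ddaA); have [a Va ->] := sigmaD i j.
rewrite mulr_sumr mulr_suml; apply: submodule_sum => [|l _].
  exact: kspan_submodule.
rewrite -!mulrA (mulrA (S i)).
apply: kspan_mull (IHw l); first exact: kspan_submodule.
move=> _ [v [l' [Vv ->]]]; apply: sub_kspan.
exists (sigma i (a l * v)), l'; split; last first.
  rewrite -[S i * _ * _]mulrA (mulrA (a l)) (mulrA (S i)) (dda_S_coef ddaA) -?mulrA//.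
  exact: powR (powsubM (Va l) Vv).
by rewrite /= mulnS; apply: sigma_powsub; exact: powsubM.
Qed.

(** In [D j * v = v * D j + delta j v] the first term crosses a word in [S] of length at most
    [m * r], at cost [q * (m * r)]; the second keeps the monomial and costs [p]. *)
Lemma std_spanD r N j x : std_span r N x ->
  std_span r.+1 (N + (p + q * (m * r))) (D j * x).
Proof.
apply: kspan_mull => [|_ [v [e [Vv e1 e2 ->]]]]; first exact: std_span_submodule.
rewrite mulrA (dda_D_coef ddaA); last exact: powR Vv.
rewrite mulrDl; apply: (submoduleD (std_span_submodule _ _)).
  rewrite -mulrA; apply: std_spanM => //.
  rewrite /monomial mulrA; have [w ew' ew] := prod_expr_word S e.1; rewrite ew'.
  move: (@D_word w j); apply: kspan_mulr => [|_ [u [l [Vu ->]]]].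
    exact: std_span_submodule.
  apply: sub_kspan; exists u, (e.1, [ffun i => (i == l) + e.2 i])%N; split.
  - apply: powsub_leq Vu => //; rewrite (leq_trans _ (leq_addl _ _))//.
    have : (\sum_i e.1 i <= \sum_(i < m) r)%N by exact: leq_sum.
    by rewrite leq_mul2l -ew sum_nat_const card_ord => ->; rewrite orbT.
  - by move=> i; exact: leqW.
  - by move=> i; rewrite ffunE -add1n leq_add// leq_b1.
  - rewrite /monomial ew' -!mulrA commuting_prod_bump.
      by congr (_ * (_ * _)); apply: eq_bigr => i _; rewrite ffunE.
    exact: (dda_D_comm ddaA).
apply: (@std_span_leq r _ (N + p)) => //; first by rewrite addnA leq_addr.
rewrite -[(N + p)%N]addn0; apply: std_spanM; first exact: delta_powsub.
apply: sub_kspan; exists 1, e; split=> //; last by rewrite mul1r.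
exact: powsub0.
Qed.

Lemma powsub_std_span r :
  powsub (V `|` range S `|` range D) r `<=` std_span r (r * (p + q * (m * r))).
Proof.
apply: (@powsub_ind _ _ _ (fun r => std_span r (r * (p + q * (m * r))))) => [t||t x y].
- exact: std_span_submodule.
- rewrite mul0n; apply: sub_kspan; exists 1, ([ffun=> 0%N], [ffun=> 0%N]).
  by split=> [|i|j|]; rewrite ?ffunE ?monomial0 ?mulr1//; exact: powsub0.
(* One more letter of any kind costs at most [p + q * (m * r)]; a letter of [V] costs 1, hence the
   need for [p > 0]. *)
rewrite {r}; have le r : (r * (p + q * (m * r)) + (p + q * (m * r)) <=
           r.+1 * (p + q * (m * r.+1)))%N.
  by rewrite -mulSnr leq_mul2l leq_add2l !leq_mul2l leqnSn !orbT.
move=> [[Vx|[i _ <-]]|[j _ <-]] y_span.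
- apply: (@std_span_leq t _ (1 + t * (p + q * (m * t)))) => //.
    by rewrite (leq_trans _ (le t))// addnC leq_add2l (leq_trans p_gt0)// leq_addr.
  exact: std_spanM (powsub_gen Vx) y_span.
- apply: (@std_span_leq t.+1 _ (t * (p + q * (m * t)))) => //.
    exact: leq_trans (leq_addr _ _) (le t).
  exact: std_spanS.
- by apply: (std_span_leq (leqnn t.+1) (le t)); exact: std_spanD.
Qed.

Lemma std_span_bounded r N : findim_subspace V ->
  exists (J : finType) (x : J -> A),
    std_span r N `<=` kspan (range x) /\
    (#|J| = kdim (powsub V N) * r.+1 ^ (m + n))%N.
Proof.
move=> Vfin; have [b [_ bV]] := findim_basis (findim_powsub N Vfin).
exists ('I_(kdim (powsub V N)) * ({ffun 'I_m -> 'I_r.+1} * {ffun 'I_n -> 'I_r.+1}))%type.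
exists (fun t => b t.1 * monomial S D (exponents t.2)).
split; last by rewrite !card_prod !card_ffun !card_ord expnD.
apply: kspan_sub => [|_ [v [e [Vv e1 e2 ->]]]]; first exact: kspan_submodule.
have : kspan (range b) v by rewrite bV.
apply: kspan_mulr => [|_ [i _ <-]]; first exact: kspan_submodule.
apply: sub_kspan.
exists (i, ([ffun l => inord (e.1 l)], [ffun l => inord (e.2 l)])) => //=.
by rewrite /monomial /=; congr (_ * (_ * _)); apply: eq_bigr => l _;
  rewrite /exponents !ffunE inordK ?ltnS.
Qed.

Lemma kdim_powsub_leq X Q r : findim_subspace V ->
    submodule X -> X `<=` powsub (V `|` range S `|` range D) Q ->
  (kdim (powsub X r) <=
   kdim (powsub V (Q * r * (p + q * (m * (Q * r))))) * (Q * r).+1 ^ (m + n))%N.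
Proof.
move=> Vfin Xsub XW.
have [J [x [xE <-]]] := std_span_bounded (Q * r) (Q * r * (p + q * (m * (Q * r)))) Vfin.
apply: (findim_bounded (powsub_submodule X r) _).2.
apply: subset_trans xE; apply: subset_trans (@powsub_std_span _).
exact: powsub_powsub.
Qed.

Lemma limn_esup_growth_leq (Rr : realType) X Q : findim_subspace V ->
    submodule X -> (0 < Q)%N -> X `<=` powsub (V `|` range S `|` range D) Q ->
    (q <= 1)%N ->
  (limn_esup (log_growth Rr X) <=
     q.+1%:R%:E * limn_esup (log_growth Rr V) + (m + n)%:R%:E)%E.
Proof.
move=> Vfin Xsub Q0 XW q1.
(* For [r > 0], [Q * r * (p + q * (m * (Q * r)))] is at most [Q * (p + q * (m * Q)) * r ^ q.+1] when
   [q <= 1], and [(Q * r).+1 <= 2 * Q * r] gives the constant [(2 * Q) ^ (m + n)]. *)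
have := @log_ratio_comparison Rr (fun r => kdim (powsub X r))
  (fun r => kdim (powsub V r)) 0 (m + n) (Q * (p + q * (m * Q))) q.+1
  ((2 * Q) ^ (m + n)).
rewrite adde0; apply=> //.
- by rewrite muln_gt0 Q0 addn_gt0 p_gt0.
- by rewrite expn_gt0 muln_gt0 Q0.
- by move=> r; exact: kdim_powsub_gt0.
move=> r r0; rewrite expn0 muln1 (leq_trans (kdim_powsub_leq r Vfin Xsub XW))//.
rewrite [leqRHS]mulnAC -expnMn [leqRHS]mulnC leq_mul//; last first.
  have [->//|mn0] := posnP (m + n); rewrite leq_exp2r// -mulnA mul2n -addnn -addn1.
  by rewrite leq_add2l muln_gt0 Q0.
apply: leq_kdim; [exact: findim_powsub|exact: findim_powsub|].
apply: powsub_leq => //; case: q q1 => [|[|//]] _.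
  by rewrite !mul0n !addn0 expn1 mulnAC.
rewrite !mul1n -mulnn mulnACA leq_mul2l mulnDl -mulnA leq_add2r.
by rewrite leq_pmulr ?orbT.
Qed.

End UpperBound.

(** * Lower bound: a large free family in the powers *)

Lemma exponents_inj r : injective (@exponents r).
Proof.
move=> [t1 t2] [u1 u2] [/ffunP tu1 /ffunP tu2]; congr (_, _); apply/ffunP => i.
  by apply/val_inj; have := tu1 i; rewrite !ffunE.
by apply/val_inj; have := tu2 i; rewrite !ffunE.
Qed.

(** Grouping a relation by monomial gives coefficients in [R], which vanish by left independence
    over [R]; freeness of [b] over [k] then kills the scalars. *)
Lemma free_monomials (d r : nat) (b : 'I_d -> A) : kfree b -> (forall i, R (b i)) ->
  free_family (fun t : 'I_d * ({ffun 'I_m -> 'I_r} * {ffun 'I_n -> 'I_r}) =>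
                 b t.1 * monomial S D (exponents t.2)).
Proof.
move=> bfree bR c c0; have [Rsub _ _] := Ralg; have [_ indep] := dda_basis ddaA.
(* Independence asks for a coefficient at every exponent vector: this one is 0 outside the image of
   [exponents], and a single term on it by injectivity. *)
pose C e := \sum_(u | @exponents r u == e) \sum_(i < d) c (i, u) *: b i.
have CE u : C (exponents u) = \sum_(i < d) c (i, u) *: b i.
  by rewrite /C (big_pred1 u)// => v; rewrite (inj_eq (@exponents_inj r)).
have CR e : R (C e).
  rewrite /C -big_filter; apply: submodule_sum => // u _.
  exact: submodule_lin.
have C0 : \sum_(e <- [seq @exponents r u | u <- index_enum _]) C e * monomial S D e = 0.
  rewrite big_map -[RHS]c0.
  transitivity (\sum_i \sum_u c (i, u) *: (b i * monomial S D (@exponents r u))).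
    rewrite exchange_big/=; apply: eq_bigr => u _; rewrite CE mulr_suml.
    by apply: eq_bigr => i _; rewrite scalerAl.
  by rewrite pair_bigA/=; apply: eq_bigr => -[].
case=> i u; apply: (bfree (fun i => c (i, u))); rewrite -CE.
apply: (indep _ C _ CR C0); last by apply: map_f; rewrite mem_index_enum.
by rewrite map_inj_uniq ?index_enum_uniq//; exact: exponents_inj.
Qed.

Lemma GKdim_ub (Rr : realType) (B V : set A) : findim_subspace V -> V `<=` B ->
  (limn_esup (log_growth Rr V) <= GKdim Rr B)%E.
Proof. by move=> Vfin VB; apply: ereal_sup_ubound; exists V. Qed.

Lemma powsub_monomial (W : set A) (e : {ffun 'I_m -> nat} * {ffun 'I_n -> nat}) :
    (forall i, W (S i)) -> (forall j, W (D j)) ->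
  powsub W (\sum_i e.1 i + \sum_j e.2 j) (monomial S D e).
Proof.
by move=> WS WD; apply: powsubM; apply: powsub_prod => i; exact: powsub_exp.
Qed.

Lemma GKdim_lower_bound (Rr : realType) :
  (GKdim Rr R + (m + n)%:R%:E <= GKdim Rr [set: A])%E.
Proof.
rewrite -leeBrDr//; apply: ge_ereal_sup => _ [V [Vfin VR] <-]; rewrite leeBrDr//.
have [b [_ bV]] := findim_basis Vfin.
pose W := kspan [set` 1 :: codom b ++ codom S ++ codom D].
have Wfin : findim_subspace W by exact: findim_span_seq.
have W1 : W 1 by apply: sub_kspan => /=; rewrite inE eqxx.
have WS i : W (S i).
  by apply: sub_kspan; rewrite /= inE !mem_cat codom_f !orbT.
have WD j : W (D j).
  by apply: sub_kspan; rewrite /= inE !mem_cat codom_f !orbT.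
have VW : V `<=` W.
  rewrite -bV; apply: kspan_sub; first exact: kspan_submodule.
  by move=> _ [i _ <-]; apply: sub_kspan; rewrite /= inE mem_cat codom_f !orbT.
apply: le_trans (GKdim_ub Rr Wfin (@subsetT _ _)).
(* Here the factor [r ^ (m + n)] sits on the side of [V], and the argument of the other dimension is
   linear in [r]. *)
have := @log_ratio_comparison Rr (fun r => kdim (powsub V r))
  (fun r => kdim (powsub W r)) (m + n) 0 (1 + m + n) 1 1.
rewrite mul1e adde0; apply=> // [r|r r0]; first exact: kdim_powsub_gt0.
rewrite expn0 muln1 mul1n expn1.
have [c [cfree cV]] := findim_basis (findim_powsub r Vfin).
have cVr i : powsub V r (c i) by rewrite -cV; apply: sub_kspan; exists i.
have <- : #|{: 'I_(kdim (powsub V r)) * ({ffun 'I_m -> 'I_r} * {ffun 'I_n -> 'I_r})}| =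
    (kdim (powsub V r) * r ^ (m + n))%N.
  by rewrite !card_prod !card_ffun !card_ord expnD.
apply: (@leq_free_kdim _ _ _ (fun t => c t.1 * monomial S D (exponents t.2))).
- exact: findim_powsub.
- apply: free_monomials => // i.
  exact: (powsub_subalgebra (dda_subalgebra ddaA) VR).
- move=> [i u] /=; rewrite !mulnDl mul1n -addnA; apply: powsubM.
    exact: (powsub_subset VW).
  apply: powsub_leq (powsub_monomial WS WD) => //.
  rewrite leq_add// -[X in (X * _)%N]card_ord -sum_nat_const leq_sum// => l _;
  by rewrite ffunE ltnW.
Qed.

(* The coefficients of a basis of [X], together with those of the [sigma i (D j)],
   span the subspace [U] fed to [stable]. *)
Lemma stable_generators (X : set A) : findim_subspace X ->
    (forall U : set A, findim_subspace U -> U `<=` R ->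
       exists (V : set A) (p : nat),
         [/\ findim_subspace V /\ V `<=` R, (1 <= p)%N, U `<=` V,
             forall i : 'I_m, sigma i @` V `<=` V &
             forall j : 'I_n, delta j @` V `<=` powsub V p]) ->
  exists (V : set A) (p Q : nat),
    [/\ [/\ findim_subspace V, V `<=` R & V 1],
        [/\ (0 < p)%N, forall i, sigma i @` V `<=` V &
            forall j, delta j @` V `<=` powsub V p],
        forall i j, exists2 a : 'I_n -> A,
          forall l, V (a l) & sigma i (D j) = \sum_(l < n) a l * D l,
        (0 < Q)%N & X `<=` powsub (V `|` range S `|` range D) Q].
Proof.
move=> Xfin stable; have [Rsub R1 RM] := Ralg; have [gen _] := dda_basis ddaA.
have [b [_ bX]] := findim_basis Xfin.
have /choice[s] : forall i, exists s : seq (_ * A), (forall t, t \in s -> R t.2) /\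
    b i = \sum_(t <- s) t.2 * monomial S D t.1.
  move=> i; have [s [c [cR ->]]] := gen (b i).
  (* Each exponent is paired with its coefficient, so that the coefficients form a finite list. *)
  exists [seq (e, c e) | e <- s]; split; last by rewrite big_map.
  by move=> _ /mapP[e _ ->]; exact: cR.
move=> /all_and2[sR bE].
have /choice[a aP] : forall ij, exists a : 'I_n -> A,
    (forall l, R (a l)) /\ sigma ij.1 (D ij.2) = \sum_(l < n) a l * D l.
  by move=> [i j]; have [a aR aE] := dda_sigma_D ddaA i j; exists a.
pose s_coefs := [seq t.2 | i <- enum 'I_(kdim X), t <- s i].
pose a_coefs := [seq a ij l | ij <- enum {: 'I_m * 'I_n}, l <- enum 'I_n].
pose U := kspan [set` 1 :: s_coefs ++ a_coefs].
have UR : U `<=` R.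
  apply: kspan_sub => // x /=; rewrite inE mem_cat => /orP[/eqP->//|/orP[]].
    by move=> /allpairsPdep[i [t [_ ts ->]]]; exact: sR ts.
  by move=> /allpairsPdep[ij [l [_ _ ->]]]; have [] := aP ij.
have [V [p [[Vfin VR] p0 UV sV dV]]] := stable U (findim_span_seq _) UR.
have seqV x : x \in 1 :: s_coefs ++ a_coefs -> V x.
  by move=> xs; apply: UV; exact: sub_kspan.
have V1 : V 1 by apply: seqV; rewrite mem_head.
have Vs i t : t \in s i -> V t.2.
  move=> ts; apply: seqV; rewrite inE mem_cat.
  suff -> : t.2 \in s_coefs by rewrite orbT.
  by apply/allpairsPdep; exists i, t; rewrite mem_enum.
have Va ij l : V (a ij l).
  apply: seqV; rewrite inE mem_cat.
  suff -> : a ij l \in a_coefs by rewrite !orbT.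
  by apply/allpairsPdep; exists ij, l; rewrite !mem_enum.
pose W := V `|` range S `|` range D.
have W1 : W 1 by do 2 left.
have WS i : W (S i) by left; right; exists i.
have WD j : W (D j) by right; exists j.
have /choice[Q bQ] : forall i, exists Q, powsub W Q (b i).
  move=> i; rewrite bE.
  (* As [W] contains 1 its powers increase, so their union is a subspace. *)
  apply: (@submodule_sum _ _ [set x | exists Q, powsub W Q x]) => [|t ts] /=.
    split=> [|c x y [Q1 x1] [Q2 x2]].
      by exists 0%N; case: (powsub_submodule W 0).
    exists (maxn Q1 Q2); case: (powsub_submodule W (maxn Q1 Q2)) => _; apply.
      exact: powsub_leq W1 (leq_maxl _ _) _ x1.
    exact: powsub_leq W1 (leq_maxr _ _) _ x2.
  exists (1 + (\sum_i t.1.1 i + \sum_j t.1.2 j))%N.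
  apply: powsubM; last exact: powsub_monomial.
  by apply: powsub_gen; do 2 left; exact: Vs ts.
exists V, p, (\max_i Q i).+1; split=> //.
  by move=> i j; have [_ aE] := aP (i, j); exists (a (i, j)).
suff: kspan (range b) `<=` powsub W (\max_i Q i).+1 by rewrite bX.
apply: kspan_sub => [|_ [i _ <-]]; first exact: powsub_submodule.
by apply: powsub_leq (bQ i) => //; apply: leqW; exact: leq_bigmax.
Qed.

End DiffDiff.

Theorem theorem3p9 (Rr : realType) (k : fieldType) (A : algType k)
    (R : set A) (m n : nat) (m_ge1 : (1 <= m)%N) (n_ge1 : (1 <= n)%N)
    (S : 'I_m -> A) (D : 'I_n -> A)
    (sigma : 'I_m -> A -> A) (delta : 'I_n -> A -> A)
    (ddaA : diff_diff_algebra R S D sigma delta)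
    (stable : forall U : set A, findim_subspace U -> U `<=` R ->
       exists (V : set A) (p : nat),
         [/\ findim_subspace V /\ V `<=` R, (1 <= p)%N, U `<=` V,
             forall i : 'I_m, sigma i @` V `<=` V &
             forall j : 'I_n, delta j @` V `<=` powsub V p]) :
  ((GKdim Rr R + (m + n)%:R%:E <= GKdim Rr [set: A])%E /\
   (GKdim Rr [set: A] <= 2%:R%:E * GKdim Rr R + (m + n)%:R%:E)%E) /\
  ((forall (i : 'I_m) (j : 'I_n), kspan (range D) (sigma i (D j))) ->
   (GKdim Rr [set: A] = GKdim Rr R + (m + n)%:R%:E)%E).
Proof.
(* Both upper bounds at once: [coefs] says in which power of [V] the coefficients of [sigma i (D j)]
   can be taken. *)
have upper q : (q <= 1)%N ->
    (forall V : set A, V 1 ->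
       (forall i j, exists2 a : 'I_n -> A,
          forall l, V (a l) & sigma i (D j) = \sum_(l < n) a l * D l) ->
       forall i j, exists2 a : 'I_n -> A,
         forall l, powsub V q (a l) & sigma i (D j) = \sum_(l < n) a l * D l) ->
    (GKdim Rr [set: A] <= q.+1%:R%:E * GKdim Rr R + (m + n)%:R%:E)%E.
  move=> q1 coefs; apply: ge_ereal_sup => _ [X [Xfin _] <-].
  have [V [p [Q [[Vfin VR V1] [p0 sV dV] aV Q0 XQ]]]] :=
    stable_generators ddaA Xfin stable.
  apply: (le_trans (limn_esup_growth_leq ddaA VR V1 p0 sV dV (coefs V V1 aV) Rr Vfin
    (findim_submodule Xfin) Q0 XQ q1)).
  by rewrite leeD2r// lee_pmul2l ?lte_fin ?ltr0n//; exact: GKdim_ub.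
split.
  split; first exact: GKdim_lower_bound ddaA Rr.
  apply: (upper 1%N) => // V V1 aV i j; have [a Va aE] := aV i j.
  by exists a => // l; exact: powsub_gen.
move=> klin; apply/eqP; rewrite eq_le (GKdim_lower_bound ddaA Rr) andbT.
rewrite -[X in (_ <= X + _)%E]mul1e; apply: (upper 0%N) => // V V1 _ i j.
have /kspan_rangeP[c ->] := klin i j.
(* [powsub V 0] is spanned by the empty product 1, so scalar coefficients have degree 0. *)
exists (fun l => c l *: 1) => [l|].
  by apply: (@submoduleZ _ _ (powsub V 0) (c l) 1);
    [exact: powsub_submodule|exact: powsub0].
by apply: eq_bigr => l _; rewrite -scalerAl mul1r.
Qed.
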